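(* Let $J$ be an ideal on a countable set $E$. The following are equivalent: (i) $J$ is dense and countably separated; (ii) $J$ has a topological representation.
   Context: An ideal on a set $E$ is a family of subsets of $E$ closed under taking subsets and finite unions; it is always assumed to contain all singletons $\{s\}$, $s\in E$. An ideal $J$ on $E$ is dense if every infinite subset of $E$ contains an infinite subset that belongs to $J$. An ideal $J$ on a countable set $E$ is countably separated if there is a countable family $\{a_n:n<\omega\}$ of subsets of $E$ such that for all $a,b\subseteq E$ with $a\in J$ and $b\notin J$ there is $n\in\omega$ with $a\cap a_n=\emptyset$ and $b\cap a_n\notin J$. A $\sigma$-ideal on a set $X$ is a family of subsets of $X$ closed under taking subsets and countable unions, assumed to contain all singletons of $X$. Given a separable metrizable space $X$, a $\sigma$-ideal $I$ on $X$ and a countable dense set $D\subseteq X$, let $J_I=\{a\subseteq D:\mathrm{cl}(a)\in I\}$, where $\mathrm{cl}$ is closure in $X$; this is an ideal on $D$. An ideal $J$ on a countable set $E$ has a topological representation if there are such $X$, $I$, $D$ and a bijection $\rho:E\to D$ with $J=\{a\subseteq E:\rho(a)\in J_I\}$, where $\rho(a)$ is the image of $a$. *)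

(* Defs.v *)
From mathcomp Require Import all_boot all_order all_algebra.
From mathcomp Require Import all_classical all_reals all_analysis.

Set Implicit Arguments.
Unset Strict Implicit.
Unset Printing Implicit Defensive.

Import Order.TTheory GRing.Theory Num.Theory.

Local Open Scope classical_set_scope.
Local Open Scope ring_scope.

(* [J set0] is closure under the empty union. *)
Definition ideal (E : Type) (J : set (set E)) : Prop :=
  [/\ J set0,
      forall a b : set E, a `<=` b -> J b -> J a,
      forall a b : set E, J a -> J b -> J (a `|` b)
    & forall s : E, J [set s]].

Definition sigma_ideal (X : Type) (I : set (set X)) : Prop :=
  [/\ I set0,
      forall a b : set X, a `<=` b -> I b -> I a,
      forall a : nat -> set X, (forall n, I (a n)) -> I (\bigcup_n a n)
    & forall x : X, I [set x]].

Definition dense_ideal (E : Type) (J : set (set E)) : Prop :=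
  forall a : set E, infinite_set a ->
    exists b : set E, [/\ infinite_set b, b `<=` a & J b].

Definition countably_separated (E : Type) (J : set (set E)) : Prop :=
  exists c : nat -> set E, forall a b : set E, J a -> ~ J b ->
    exists n : nat, a `&` c n = set0 /\ ~ J (b `&` c n).

(* Nonnegativity of the metric [d] follows from the other axioms. *)
Definition metrizable (R : realType) (X : topologicalType) : Prop :=
  exists d : X -> X -> R,
    [/\ forall x y, d x y = 0 <-> x = y,
        forall x y, d x y = d y x,
        forall x y z, d x z <= d x y + d y z
      & forall (x : X) (A : set X),
          nbhs x A <-> exists2 e : R, 0 < e & [set y | d x y < e] `<=` A].

Definition separable (X : topologicalType) : Prop :=
  exists2 S : set X, countable S & dense S.

Definition closure_ideal (X : topologicalType) (I : set (set X)) (D : set X) :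
    set (set X) :=
  [set a | a `<=` D /\ I (closure a)].

(* [R] is only the value field of the metrics; any two realTypes are isomorphic
   ordered fields. *)
Definition topologically_representable (R : realType) (E : Type)
    (J : set (set E)) : Prop :=
  exists (X : topologicalType) (I : set (set X)) (D : set X) (rho : E -> X),
    [/\ separable X /\ metrizable R X,
        sigma_ideal I,
        countable D /\ dense D,
        set_bij [set: E] D rho
      & J = [set a | closure_ideal I D (rho @` a)]].

(* Main.v *)
(* If [J] is represented on [D] in [X], an infinite subset of [D] is either closed,
   hence countable and in [I], or contains a sequence converging to a point; and
   a countable base of [X] traces a separating family.
   Conversely, coding each [e] by the bits "[e] belongs to [c n]" embeds [E] into
   the Cantor space; [X] is the closure of the image and [I] consists of the sets
   covered by countably many closures of members of [J]. Density of [J] puts the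
   singletons into [I]. If [b] is not in [J] and the [a k] are, then one builds a
   decreasing sequence of [J]-positive subsets of [b], the [k]-th step avoiding
   [a k] by a separating set and deciding the [k]-th bit: the bits so decided form
   a point of [closure b] outside every [closure (a k)], so [closure b] is not in
   [I]. *)

Require Import Defs.
From HB Require Import structures.
From mathcomp Require Import all_boot all_order all_algebra.
From mathcomp Require Import all_classical all_reals all_analysis.
From mathcomp Require Import lra.

Set Implicit Arguments.
Unset Strict Implicit.
Unset Printing Implicit Defensive.

Import Order.TTheory GRing.Theory Num.Theory.

Local Open Scope classical_set_scope.

(** * Small sets in ideals and $\sigma$-ideals *)

Lemma ideal_finite_set (E : Type) (J : set (set E)) (A : set E) :
  ideal J -> finite_set A -> J A.
Proof.
elim/Pchoice: E => E in J A *.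
move=> [J0 Jsub JU J1] /finite_seqP[s ->].
elim: s => [|x s IHs]; first by rewrite set_nil.
apply: Jsub (JU _ _ (J1 x) IHs) => y /=.
by rewrite inE => /orP[/eqP|]; [left|right].
Qed.

Lemma sigma_ideal_countable (X : Type) (I : set (set X)) (A : set X) :
  sigma_ideal I -> countable A -> I A.
Proof.
move=> [I0 Isub Ibigcup I1] /countable_injP[f finj].
(* Each fibre of the injection [f] in [A] has at most one point. *)
apply: (Isub _ (\bigcup_n (A `&` f @^-1` [set n]))).
  by move=> x Ax; exists (f x).
apply: Ibigcup => n; have [[x [Ax fx]]|noA] := pselect (A `&` f @^-1` [set n] !=set0).
  apply: Isub (I1 x) => y [Ay fy] /=.
  by apply: finj; rewrite ?inE//= fx fy.
by apply: Isub I0 => x Ax; apply: noA; exists x.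
Qed.

Lemma sigma_idealU (X : Type) (I : set (set X)) (A B : set X) :
  sigma_ideal I -> I A -> I B -> I (A `|` B).
Proof.
by move=> [I0 _ Ibigcup _] IA IB; rewrite -bigcup2E; apply: Ibigcup => -[|[|n]].
Qed.

(** * Closures and convergent sequences in a metrizable space *)

Definition compatible_metric (R : realType) (X : topologicalType)
    (d : X -> X -> R) : Prop :=
  [/\ forall x y, d x y = 0%R <-> x = y,
      forall x y, d x y = d y x,
      forall x y z, (d x z <= d x y + d y z)%R
    & forall (x : X) (A : set X),
        nbhs x A <-> exists2 e : R, (0 < e)%R & [set y | (d x y < e)%R] `<=` A].

Section compatible_metric.
Context (R : realType) (X : topologicalType) (d : X -> X -> R).
Context (dX : compatible_metric d).

Lemma compatible_metric_ge0 x y : (0 <= d x y)%R.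
Proof.
have [d0 dC dD _] := dX.
have := dD x y x; rewrite (dC y x) (d0 x x).2//; lra.
Qed.

Lemma compatible_metric_gt0 x y : x <> y -> (0 < d x y)%R.
Proof.
have [d0 _ _ _] := dX.
move=> xy; rewrite lt_neqAle compatible_metric_ge0 andbT eq_sym.
by apply/eqP => /d0.
Qed.

Lemma nbhs_metric_ball x (e : R) : (0 < e)%R -> nbhs x [set y | (d x y < e)%R].
Proof. by have [_ _ _ dn] := dX; move=> e0; apply/dn; exists e. Qed.

Lemma open_metric_ball x (e : R) : open [set y | (d x y < e)%R].
Proof.
have [d0 dC dD dn] := dX; rewrite openE => y /= xy; apply/dn.
exists (e - d x y)%R; first by rewrite subr_gt0.
by move=> z /= yz; have := dD x y z; lra.
Qed.

Lemma closure_metric A x :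
  closure A x <-> forall e : R, (0 < e)%R -> exists2 y, A y & (d x y < e)%R.
Proof.
have [d0 dC dD dn] := dX; split=> [clA e e0|clA B /dn[e e0 eB]].
  by have [y [Ay xy]] := clA _ (nbhs_metric_ball x e0); exists y.
by have [y Ay xy] := clA e e0; exists y; split => //; exact: eB.
Qed.

Lemma compatible_metric_accessible : accessible_space X.
Proof.
have [d0 _ _ _] := dX.
move=> x y /eqP xy; exists [set z | (d x z < d x y)%R].
split; first exact: open_metric_ball.
- by rewrite inE /= (d0 x x).2// compatible_metric_gt0.
- by rewrite inE /= ltxx.
Qed.

(** Points [g n] of [A] other than [x] are chosen within 1/(n+1) of [x]. A finite range would be
    closed and so contain [x]. For [y] other than [x], almost all terms lie within half of [d x y]
    of [x], so [y] is in the closure only if it is one of the finitely many others. *)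
Lemma limit_point_convergent_subset (A : set X) x : limit_point A x ->
  exists B, [/\ infinite_set B, countable B, B `<=` A & closure B `<=` x |` B].
Proof.
have [d0 dC dD _] := dX.
move=> Ax.
have gP n : exists y, [/\ y <> x, A y & (d x y < n.+1%:R^-1)%R].
  have [|y [/eqP yx Ay xy]] := Ax _ (nbhs_metric_ball x (e := n.+1%:R^-1)%R _).
    by rewrite invr_gt0 ltr0n.
  by exists y.
have [g {}gP] := choice gP.
have gN (e : R) : (0 < e)%R -> exists N, forall n, (N <= n)%N -> (d x (g n) < e)%R.
  move=> e0; have [N _ NP] := near_infty_natSinv_lt (PosNum e0).
  exists N => n /NP /=; apply: lt_trans.
  by have [] := gP n.
have Tfin := compatible_metric_accessible.
rewrite accessible_finite_set_closed in Tfin.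
exists (range g); split.
- move=> /Tfin/closure_id gE.
  have : range g x.
    rewrite gE closure_metric => e /gN[N] /(_ N (leqnn N)) gNe.
    by exists (g N).
  by move=> [n _ gnx]; have [] := gP n.
- exact: card_image_le.
- by move=> _ [n _ <-]; have [] := gP n.
- move=> y cly; have [->|yx] := pselect (y = x); [by left|right].
  have r0 : (0 < d x y / 2)%R.
    by rewrite divr_gt0// compatible_metric_gt0// => /esym.
  have [N NP] := gN _ r0.
  have sub : range g `<=` g @` `I_N `|` [set z | (d x z < d x y / 2)%R].
    move=> _ [n _ <-]; have [nN|Nn] := ltnP n N; first by left; exists n.
    by right; apply: NP.
  have := closureS sub cly; rewrite closureU => -[|].
    have /Tfin/closure_id <- : finite_set (g @` `I_N) by exact: finite_image.
    by move=> [n _ <-]; exists n.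
  rewrite closure_metric => /(_ _ r0)[z /= xz yz].
  have := dD x z y; rewrite (dC z y); lra.
Qed.

End compatible_metric.

(** * From a representation to density and countable separation *)

Lemma closed_no_limit_point (X : topologicalType) (A : set X) :
  (forall x, ~ limit_point A x) -> closure A = A.
Proof.
move=> nA; apply/seteqP; split; last exact: subset_closure.
rewrite closure_isolated_limit_point => x [/isolatedS//|/nA//].
Qed.

Lemma representable_dense_ideal (R : realType) (E : Type) (J : set (set E)) :
  topologically_representable R J -> dense_ideal J.
Proof.
move=> [X [I [D [rho [[_ [d dX]] sI [cD _] [rhoD rho_inj _] JE]]]]].
have [_ Isub _ I1] := sI.
move=> a a_inf.
have rhoaD (b : set E) : rho @` b `<=` D by move=> _ [e _ <-]; exact: rhoD.
have [[x /(limit_point_convergent_subset dX)[B [Binf Bcount Ba Bx]]]|nolim] :=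
    pselect (exists x, limit_point (rho @` a) x).
  have BE : rho @` (rho @^-1` B) = B.
    apply/seteqP; split; first exact: image_preimage_subset.
    by move=> y By; have [e _ ey] := Ba _ By; exists e => //=; rewrite ey.
  exists (rho @^-1` B); split.
  - by move=> fB; apply: Binf; rewrite -BE; exact: finite_image.
  - by move=> e /= /Ba[e' ae' /rho_inj]; rewrite !inE => <-.
  - rewrite JE; split=> //; rewrite BE.
    apply: Isub Bx _; apply: sigma_idealU => //.
    exact: sigma_ideal_countable.
exists a; split => //; rewrite JE; split => //.
rewrite closed_no_limit_point; last by move=> x lx; apply: nolim; exists x.
apply: sigma_ideal_countable => //.
exact: sub_countable (subset_card_le _) cD.
Qed.

Lemma countably_separated_countType (E : Type) (J : set (set E)) (K : countType)
    (c : K -> set E) :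
  (forall a b, J a -> ~ J b -> exists k, a `&` c k = set0 /\ ~ J (b `&` c k)) ->
  countably_separated J.
Proof.
move=> cP; exists (fun n => if unpickle n is Some k then c k else set0).
move=> a b Ja nJb; have [k ck] := cP a b Ja nJb.
by exists (pickle k); rewrite pickleK.
Qed.

(* A countable base of [X] traces a separating family on [D]: the basic open
   sets missing [closure a] cover the part of [closure b] outside [closure a],
   and [closure b `&` U `<=` closure (b `&` U)] for [U] open. *)
Lemma representable_countably_separated (R : realType) (E : Type)
    (J : set (set E)) :
  countable [set: E] -> topologically_representable R J ->
  countably_separated J.
Proof.
(* With [E] a [countType], pairs in [T * nat] can index the separating family. *)
case/Pcountable => T ET; subst E.
move=> [X [I [D [rho [[_ [d dX]] sI [cD Ddense] [rhoD rho_inj rho_surj] JE]]]]].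
have [I0 Isub IU _] := sI.
have [d0 dC dD _] := dX.
have rhoaD (b : set T) : rho @` b `<=` D by move=> _ [e _ <-]; exact: rhoD.
pose U (p : T * nat) := [set y | (d (rho p.1) y < p.2.+1%:R^-1)%R].
apply: (@countably_separated_countType _ _ _ (fun p => rho @^-1` U p)) => a b.
rewrite {1 2}JE => -[_ Ia] nIb.
(* If no [U p] separates, every [V p] below is in [I], and these with [closure (rho @]
   a)[cover]closure (rho @[b)]. *)
apply: contrapT => noU; apply: nIb; split => //.
pose V p := if pselect (rho @` a `&` U p = set0)
  then closure (rho @` (b `&` rho @^-1` U p)) else set0.
have IV p : I (V p).
  rewrite /V; case: pselect => // aU.
  have : J (b `&` rho @^-1` U p).
    apply: contrapT => nJ; apply: noU; exists p; split => //.
    rewrite -subset0 => e [ae Ue]; have : (rho @` a `&` U p) (rho e).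
      by split => //; exists e.
    by rewrite aU.
  by rewrite JE => -[].
pose W n := if n is n'.+1 then
  (if unpickle n' is Some p then V p else set0) else closure (rho @` a).
apply: Isub (IU W _); last by move=> [|n]//=; case: unpickle.
move=> x bx; have [ax|nax] := pselect (closure (rho @` a) x); first by exists 0%N.
have [e e0 ae] : exists2 e : R, (0 < e)%R & forall y, (rho @` a) y -> (e <= d x y)%R.
  apply: contrapT => H; apply: nax; apply/(closure_metric dX) => e e0.
  apply: contrapT => H2; apply: H; exists e => // y ay; rewrite leNgt.
  by apply/negP => xy; apply: H2; exists y.
have e20 : (0 < e / 2)%R by rewrite divr_gt0.
have [N _ /(_ N (leqnn N)) NP] := near_infty_natSinv_lt (PosNum e20).
have {}NP : (N.+1%:R^-1 < e / 2)%R by [].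
have N0 : (0 < N.+1%:R^-1 :> R)%R by rewrite invr_gt0 ltr0n.
have [y [/= xy Dy]] : [set y | (d x y < N.+1%:R^-1)%R] `&` D !=set0.
  apply: Ddense; last exact: open_metric_ball.
  by exists x; rewrite /= (d0 x x).2.
have [t _ ty] := rho_surj y Dy.
have Ux : U (t, N) x by rewrite /U /= ty dC.
exists (pickle (t, N)).+1 => //=; rewrite pickleK /V; case: pselect; last first.
  case; rewrite -subset0 => z [/ae + Uz].
  have := dD x y z; rewrite /U /= ty in Uz.
  move=> dxz; rewrite leNgt => /negP; apply; apply: le_lt_trans dxz _.
  by rewrite [e]splitr ltrD// (lt_trans _ NP).
move=> _ B Bx.
have := bx (B `&` U (t, N)) _; case.
  apply: filterI => //; apply: open_nbhs_nbhs; split => //.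
  exact: open_metric_ball.
move=> _ [[s bs <-] [Bs Us]]; exists (rho s); split => //.
by exists s.
Qed.

(** * The space of codes and its metric *)

Definition agree (n : nat) (x y : nat -> bool) : Prop :=
  forall i, (i < n)%N -> x i = y i.

Lemma agree_sym n x y : agree n x y -> agree n y x.
Proof. by move=> xy i /xy. Qed.

Lemma agree_trans n x y z : agree n x y -> agree n y z -> agree n x z.
Proof. by move=> xy yz i ni; rewrite xy// yz. Qed.

Lemma agree_le m n x y : (m <= n)%N -> agree n x y -> agree m x y.
Proof. by move=> mn xy i im; apply: xy; exact: leq_trans mn. Qed.

Section code_closure.
Context (E : Type) (c : nat -> set E).

Definition code (e : E) : nat -> bool := fun n => `[< c n e >].

(* The closure in the Cantor space of the set of codes. *)
Definition code_closure : Type :=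
  {x : nat -> bool | forall n, exists e, agree n x (code e)}.

HB.instance Definition _ := gen_eqMixin code_closure.
HB.instance Definition _ := gen_choiceMixin code_closure.

(** The topology induced by the Cantor space: a basic neighbourhood fixes an initial segment of
    bits. *)
Definition code_nbhs (x : code_closure) : set_system code_closure :=
  [set A | exists n, [set y | agree n (sval x) (sval y)] `<=` A].

HB.instance Definition _ := hasNbhs.Build code_closure code_nbhs.

Lemma code_nbhs_filter (x : code_closure) : ProperFilter (nbhs x).
Proof.
apply: Build_ProperFilter_ex; first by move=> A [n nA]; exists x; apply: nA.
split; first by exists 0%N.
- move=> A B [m mA] [n nB]; exists (maxn m n) => y xy.
  by split; [apply: mA|apply: nB]; apply: agree_le xy; rewrite ?leq_maxl ?leq_maxr.
- by move=> A B AB [n nA]; exists n; exact: subset_trans AB.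
Qed.

Lemma code_nbhs_singleton (x : code_closure) (A : set code_closure) :
  nbhs x A -> A x.
Proof. by move=> [n nA]; apply: nA. Qed.

Lemma code_nbhs_nbhs (x : code_closure) (A : set code_closure) :
  nbhs x A -> nbhs x (nbhs^~ A).
Proof.
move=> [n nA]; exists n => y xy; exists n => z yz; apply: nA.
exact: agree_trans yz.
Qed.

HB.instance Definition _ := Nbhs_isNbhsTopological.Build code_closure
  code_nbhs_filter code_nbhs_singleton code_nbhs_nbhs.

Lemma code_closure_agree (x y : code_closure) :
  (forall n, agree n (sval x) (sval y)) -> x = y.
Proof.
move=> xy; apply: eq_sig_hprop => [? ? ?|]; first exact: Prop_irrelevance.
by apply/funext => n; exact: (xy n.+1 n (leqnn _)).
Qed.

Lemma closure_code (A : set code_closure) x :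
  closure A x <-> forall n, exists2 y, A y & agree n (sval x) (sval y).
Proof.
split=> [clA n|clA B [n nB]].
  by have [|y [Ay xy]] := clA [set y | agree n (sval x) (sval y)];
    [exists n|exists y].
by have [y Ay xy] := clA n; exists y; split => //; exact: nB.
Qed.

(** The usual ultrametric, 1/(m+1) for [m] the first bit of disagreement. *)
Definition code_dist (R : realType) (x y : code_closure) : R :=
  if pselect (exists n, sval x n != sval y n) is left xy
  then (ex_minn xy).+1%:R^-1%R else 0%R.

Lemma code_dist_ge0 (R : realType) x y : (0 <= code_dist R x y)%R.
Proof. by rewrite /code_dist; case: pselect => // ?; rewrite invr_ge0. Qed.

Lemma code_dist_lt (R : realType) x y n :
  (code_dist R x y < n.+1%:R^-1)%R <-> agree n.+1 (sval x) (sval y).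
Proof.
rewrite /code_dist; case: pselect => [xy|nxy]; last first.
  split=> [_ i _|_]; last by rewrite invr_gt0 ltr0n.
  by apply: contrapT => /eqP xyi; apply: nxy; exists i.
case: ex_minnP => m xym mmin.
rewrite ltf_pV2 ?posrE ?ltr0n// ltr_nat ltnS; split=> [nm i|nxy].
  rewrite ltnS => ni; apply/eqP; apply: contraTT (leq_ltn_trans ni nm) => /mmin.
  by rewrite -leqNgt.
by rewrite ltnNge; apply: contraNN xym => mn; rewrite nxy.
Qed.

Lemma code_dist_eq0 (R : realType) x y : code_dist R x y = 0%R <-> x = y.
Proof.
split=> [d0|->].
  apply: code_closure_agree => n; apply: (@agree_le _ n.+1) => //.
  by apply/(code_dist_lt R); rewrite d0 invr_gt0 ltr0n.
by rewrite /code_dist; case: pselect => // yy; exfalso; case: yy => n; rewrite eqxx.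
Qed.

(** Otherwise [x] and [y] would agree up to and including the first bit where [u] and [v] differ.
    Used in both directions, this gives symmetry. *)
Lemma le_code_dist (R : realType) x y u v :
  (forall n, agree n (sval x) (sval y) -> agree n (sval u) (sval v)) ->
  (code_dist R u v <= code_dist R x y)%R.
Proof.
move=> xyuv; rewrite leNgt; apply/negP.
rewrite [code_dist R u v]/code_dist; case: pselect => [uv|_]; last first.
  by rewrite ltNge code_dist_ge0.
case: ex_minnP => m uvm _ /code_dist_lt /xyuv/(_ m (leqnn _)) uvE.
by rewrite uvE eqxx in uvm.
Qed.

(** If the sum were below 1/(m+1), where [m] is the first bit separating [x] from [z], both terms
    would be, and [y] would share bit [m] with [x] and with [z]. *)
Lemma code_dist_triangle (R : realType) (x y z : code_closure) :
  (code_dist R x z <= code_dist R x y + code_dist R y z)%R.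
Proof.
rewrite leNgt; apply/negP.
have := code_dist_ge0 R x y; have := code_dist_ge0 R y z.
rewrite [code_dist R x z]/code_dist; case: pselect => [xz|_]; last first.
  by move=> yz0 xy0; rewrite ltNge addr_ge0.
case: ex_minnP => m xzm _ yz0 xy0 lt_m.
have /code_dist_lt/(_ m (leqnn _)) xym : (code_dist R x y < m.+1%:R^-1)%R.
  by apply: le_lt_trans lt_m; rewrite lerDl.
have /code_dist_lt/(_ m (leqnn _)) yzm : (code_dist R y z < m.+1%:R^-1)%R.
  by apply: le_lt_trans lt_m; rewrite lerDr.
by rewrite xym yzm eqxx in xzm.
Qed.

Lemma code_closure_metrizable (R : realType) : metrizable R code_closure.
Proof.
exists (code_dist R); split.
- exact: code_dist_eq0.
- move=> x y; apply/eqP; rewrite eq_le.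
  by apply/andP; split; apply: le_code_dist => n; exact: agree_sym.
- exact: code_dist_triangle.
- move=> x A; split=> [[n nA]|[e e0 eA]].
    exists n.+1%:R^-1%R; first by rewrite invr_gt0 ltr0n.
    by move=> y /code_dist_lt /(agree_le (leqnSn n)) /nA.
  have [N _ /(_ N (leqnn N))/= Ne] := near_infty_natSinv_lt (PosNum e0).
  by exists N.+1 => y xy; apply: eA; apply: lt_trans Ne; apply/code_dist_lt.
Qed.

Lemma code_in_closure e n : exists e', agree n (code e) (code e').
Proof. by exists e. Qed.

Definition code_point (e : E) : code_closure := exist _ (code e) (code_in_closure e).

Lemma dense_code_point : dense (range code_point).
Proof.
move=> U [x Ux]; rewrite openE => /(_ _ Ux)[n nU].
have [e xe] := svalP x n; exists (code_point e); split; first exact: nU.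
by exists e.
Qed.

Lemma closure_code_point (a : set E) x :
  closure (code_point @` a) x <->
  forall n, exists2 e, a e & agree n (sval x) (code e).
Proof.
rewrite closure_code; split=> xa n; have := xa n.
  by move=> [_ [e ae <-] xe]; exists e.
by move=> [e ae xe]; exists (code_point e) => //; exists e.
Qed.

(** * The $\sigma$-ideal generated by closures of members of [J] *)

Context (J : set (set E)) (idealJ : ideal J).

Definition closure_covered : set (set code_closure) :=
  [set A | exists a : nat -> set E,
    (forall n, J (a n)) /\ A `<=` \bigcup_n closure (code_point @` a n)].

(** Let [g n] have a code agreeing with [x] on [n] bits. If [range g] is finite, it is in [J]
    itself; otherwise density gives an infinite [b] in [J] inside it. Only [g 0], ..., [g (n-1)] can
    fail to agree with [x] on [n] bits, so [x] is in the closure of [b]. *)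
Lemma closure_covered_singleton x : dense_ideal J -> closure_covered [set x].
Proof.
move=> denseJ; have [_ _ _ J1] := idealJ.
have [g gP] := choice (svalP x).
suff [b Jb bx] : exists2 b, J b & closure (code_point @` b) x.
  by exists (fun=> b); split=> // _ ->; exists 0%N.
have [/(ideal_finite_set idealJ) Jg|/denseJ[b [b_inf bg Jb]]] :=
    pselect (finite_set (range g)).
  exists (range g) => //; apply/closure_code_point => n.
  by exists (g n) => //; exists n.
exists b => //; apply/closure_code_point => n.
apply: contrapT => nb; apply: b_inf.
apply: (@sub_finite_set _ _ (g @` `I_n)); last exact: finite_image.
move=> e be; have [k _ gk] := bg _ be; exists k => //=.
rewrite ltnNge; apply/negP => nk; apply: nb; exists e => //.
by rewrite -gk; apply: agree_le nk _; exact: gP.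
Qed.

Lemma closure_covered_sigma_ideal : dense_ideal J -> sigma_ideal closure_covered.
Proof.
move=> denseJ; have [J0 _ _ _] := idealJ; split.
- by exists (fun=> set0); split.
- by move=> A B AB [a [Ja Ba]]; exists a; split=> //; exact: subset_trans Ba.
- move=> A /choice[a aP].
  exists (fun n => if unpickle n is Some (i, j) then a i j else set0); split.
    by move=> n; case: unpickle => // -[i j]; have [] := aP i.
  move=> x [i _ Ax]; have [_ /(_ x Ax)[j _ xa]] := aP i.
  by exists (pickle (i, j)) => //; rewrite pickleK.
- by move=> x; exact: closure_covered_singleton.
Qed.

Context (sepJ : forall a b : set E, J a -> ~ J b ->
  exists n, a `&` c n = set0 /\ ~ J (b `&` c n)).

(** One step of the construction: the separating set gives a positive [b]&[c n], and since [J] is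
    closed under unions, one of the two pieces into which [c k] cuts it is positive. *)
Lemma positive_refinement (a b : set E) k : J a -> ~ J b ->
  exists b', [/\ ~ J b', b' `<=` b,
    exists2 n, b' `<=` c n & a `&` c n = set0 &
    exists u, forall e, b' e -> code e k = u].
Proof.
move=> Ja nJb; have [_ _ JU _] := idealJ.
have [n [acn nJbn]] := sepJ Ja nJb.
have [Jk|nJk] := pselect (J (b `&` c n `&` c k)).
  exists (b `&` c n `\` c k); split.
  - by move=> J'; apply: nJbn; rewrite -(setUIDK (b `&` c n) (c k)); exact: JU.
  - by move=> e [[]].
  - by exists n => // e [[]].
  - by exists false => e [_ nce]; apply/asboolPn.
exists (b `&` c n `&` c k); split=> //.
- by move=> e [[]].
- by exists n => // e [[]].
- by exists true => e [_ ce]; apply/asboolP.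
Qed.

Lemma closure_covered_ideal (b : set E) :
  closure_covered (closure (code_point @` b)) -> J b.
Proof.
move=> [a [Ja ba]]; apply: contrapT => nJb; have [J0 Jsub JU _] := idealJ.
(* Positivity of [b1] is a premise inside [next], so that [choice] yields a total function to
   iterate. *)
pose next (k : nat) (b1 b2 : set E) := ~ J b1 -> [/\ ~ J b2, b2 `<=` b1,
    exists2 n, b2 `<=` c n & a k `&` c n = set0 &
    exists u, forall e, b2 e -> code e k = u].
have /choice[f fP] : forall p : nat * set E, exists b', next p.1 p.2 b'.
  move=> [k b1]; have [Jb1|nJb1] := pselect (J b1); first by exists b1.
  by have [b' b'P] := positive_refinement k (Ja k) nJb1; exists b'.
pose B := fix B n := if n is n'.+1 then f (n', B n') else b.
have nJB n : ~ J (B n) by elim: n => //= n /(fP (n, _))[].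
have BS n : B n.+1 `<=` B n by have [] := fP (n, B n) (nJB n).
have Ble m n : (m <= n)%N -> B n `<=` B m.
  elim: n => [|n IHn]; first by rewrite leqn0 => /eqP->.
  rewrite leq_eqVlt => /predU1P[->//|]; rewrite ltnS => /IHn.
  exact: subset_trans.
have Bn0 n : exists e, B n e.
  apply: contrapT => Bn; apply: (nJB n); apply: Jsub J0 => e Be.
  by apply: Bn; exists e.
(* Step [n] decides bit [n], so the limit point [x] is read off from the sets [B n.+1]. *)
have /choice[x xP] n : exists u, forall e, B n.+1 e -> code e n = u.
  by have [] := fP (n, B n) (nJB n).
have Bagree n e : B n e -> agree n x (code e).
  by move=> Be i ni; rewrite (xP i)//; exact: (Ble i.+1 n).
have xcl n : exists e, agree n x (code e).
  by have [e /Bagree] := Bn0 n; exists e.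
have bx : closure (code_point @` b) (exist _ x xcl).
  apply/closure_code_point => n; have [e Be] := Bn0 n.
  by exists e; [exact: (Ble 0%N n)|exact: Bagree].
have [k _ /closure_code_point ax] := ba _ bx.
have [_ _ [n Bcn acn] _] := fP (k, B k) (nJB k).
(* Agreement on [n.+1] bits includes bit [n], which tests membership in [c n]. *)
have [e ae xe] := ax n.+1.
(* This stage is late enough for [e'] to lie in [B k.+1], hence in [c n], and for its bit [n] to be
   that of [x]. So [e] is in [c n] too, although [a k] misses [c n]. *)
have [e' Be'] := Bn0 (maxn k n).+1.
have cne' : c n e' by apply: Bcn; apply: (Ble k.+1) Be'; rewrite ltnS leq_maxl.
have : (a k `&` c n) e.
  split=> //; have : code e n = code e' n.
    rewrite -(xe n)//=; apply: (Bagree _ _ Be').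
    by rewrite ltnS leq_maxr.
  rewrite /code => ee'; apply/asboolP; rewrite ee'; exact/asboolP.
by rewrite acn.
Qed.

Lemma code_topologically_representable (R : realType) :
  countable [set: E] -> injective code_point -> dense_ideal J ->
  topologically_representable R J.
Proof.
move=> cE inj denseJ.
have cD : countable (range code_point).
  exact: sub_countable (card_image_le _ _) cE.
exists code_closure, closure_covered, (range code_point), code_point; split.
- split; last exact: code_closure_metrizable.
  by exists (range code_point) => //; exact: dense_code_point.
- exact: closure_covered_sigma_ideal.
- by split=> //; exact: dense_code_point.
- by split=> [e _|? ? _ _ /inj|]//; exists e.
- apply/seteqP; split=> [b Jb|b [_ /closure_covered_ideal]//].
  split; first exact: image_subset.
  by exists (fun=> b); split=> // x bx; exists 0%N.
Qed.

End code_closure.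

(** * The representation and the equivalence *)

Lemma countably_separated_topologically_representable (R : realType) (E : Type)
    (J : set (set E)) : countable [set: E] -> ideal J -> dense_ideal J ->
  countably_separated J -> topologically_representable R J.
Proof.
move=> cE idealJ denseJ [c cP].
have /countable_injP[f f_inj] := cE.
(* Adding the singletons to the separating family makes the coding injective. *)
pose c' n := if odd n then f @^-1` [set n./2] else c n./2.
have c'0 n : c' n.*2 = c n by rewrite /c' odd_double doubleK.
have c'1 n : c' n.*2.+1 = f @^-1` [set n].
  by rewrite /c' /= odd_double /= uphalf_double.
apply: (@code_topologically_representable _ c') => //.
  by move=> a b Ja nJb; have [n] := cP a b Ja nJb; exists n.*2; rewrite c'0.
(* The bit at this odd index tests whether the value of [f] equals [f e]. *)
move=> e e' /(congr1 sval)/(congr1 (@^~ (f e).*2.+1)).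
rewrite /= /code c'1 => ee'; apply: f_inj; rewrite ?inE//.
have : `[< (f @^-1` [set f e]) e >] by apply/asboolP.
by rewrite ee' => /asboolP ->.
Qed.

Theorem theorem1p1 (R : realType) (E : Type) (J : set (set E))
    (hE : countable [set: E]) (hJ : ideal J) :
  (dense_ideal J /\ countably_separated J) <->
  topologically_representable R J.
Proof.
split=> [[denseJ sepJ]|repJ].
  exact: countably_separated_topologically_representable.
split; first exact: representable_dense_ideal repJ.
exact: representable_countably_separated repJ.
Qed.
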